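(* Let $m\ge 1$ be an integer. For a real symmetric positive definite $m\times m$ matrix $A$ let $\lambda_m(A)$ denote its smallest eigenvalue and put $$L_L(A)=\frac{1}{\mathrm{Tr}(A^{-1})}\cdot\frac{m}{1+\sqrt{(m-1)\left[m\cdot\frac{\mathrm{Tr}(A^{-2})}{\{\mathrm{Tr}(A^{-1})\}^2}-1\right]}}.$$ Among the lower bounds on $\lambda_m(A)$ computed from $\mathrm{Tr}(A^{-1})$ and $\mathrm{Tr}(A^{-2})$, the bound $L_L(A)$ is optimal in terms of sharpness. That is, $L_L(A)\le\lambda_m(A)$ for every real symmetric positive definite $m\times m$ matrix $A$; and if $\varphi$ is any real-valued function of two real variables such that $\varphi(\mathrm{Tr}(A^{-1}),\mathrm{Tr}(A^{-2}))\le\lambda_m(A)$ for every real symmetric positive definite $m\times m$ matrix $A$, then $\varphi(\mathrm{Tr}(A^{-1}),\mathrm{Tr}(A^{-2}))\le L_L(A)$ for every such $A$.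
   Context: The quantity $L_L(A)$ is called the Laguerre bound. A lower bound formula based solely on $\mathrm{Tr}(A^{-1})$ and $\mathrm{Tr}(A^{-2})$ is called optimal if, for matrices of the given size $m$, it always gives a bound at least as sharp (that is, at least as large) as any other valid lower bound formula that uses only $\mathrm{Tr}(A^{-1})$ and $\mathrm{Tr}(A^{-2})$. *)

(* Defs.v *)
From mathcomp Require Import all_boot all_order all_algebra.
From mathcomp Require Import all_classical all_reals.
Set Implicit Arguments.
Unset Strict Implicit.
Unset Printing Implicit Defensive.
Import Order.TTheory GRing.Theory Num.Theory.
Local Open Scope classical_set_scope.
Local Open Scope ring_scope.

Definition sym_posdef (R : realType) (m : nat) (A : 'M[R]_m) : Prop :=
  A \is symmetricmx /\
  forall x : 'cV[R]_m, x != 0 -> 0 < (x^T *m A *m x) 0 0.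

(* The least element of the set of eigenvalues. The default value 0 of [xget]
   is returned only when there is no least eigenvalue, which does not happen
   for a symmetric matrix of size m >= 1. *)
Definition smallest_eigenvalue (R : realType) (m : nat) (A : 'M[R]_m) : R :=
  let eigs : set R := [set l | eigenvalue A l] in
  xget 0 (eigs `&` lbound eigs).

Definition tr_inv (R : realType) (m : nat) (A : 'M[R]_m) : R :=
  \tr (invmx A).

Definition tr_inv2 (R : realType) (m : nat) (A : 'M[R]_m) : R :=
  \tr (invmx A *m invmx A).

Definition laguerre_bound (R : realType) (m : nat) (A : 'M[R]_m) : R :=
  (tr_inv A)^-1 *
  (m%:R / (1 + Num.sqrt ((m%:R - 1) *
                         (m%:R * (tr_inv2 A / tr_inv A ^+ 2) - 1)))).

(* Main.v *)
Require Import Defs.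
From mathcomp Require Import all_boot all_order all_algebra.
From mathcomp Require Import all_classical all_reals.
From mathcomp Require Import complex ring lra.
Import Order.TTheory GRing.Theory Num.Theory.
Local Open Scope ring_scope.

(** Let [A] be symmetric positive definite and let [x_1, ..., x_m] be the
    reciprocals of its eigenvalues. Then [Tr(A^-1)] and [Tr(A^-2)] are the power
    sums [p1 = sum x_i] and [p2 = sum x_i^2], and the smallest eigenvalue is the
    reciprocal of the largest [x_i]. So the best lower bound that depends only on
    [p1] and [p2] is the reciprocal of the largest value that an entry of a
    positive vector with these two power sums can take.

    For one entry [x_k], Cauchy-Schwarz applied to the other [m - 1] entries gives
    [(p1 - x_k)^2 <= (m - 1) (p2 - x_k^2)]. This is a quadratic inequality in
    [x_k], whose larger root [laguerre_top] is the reciprocal of the Laguerre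
    bound; hence the bound is valid ([le_laguerre_top]). Equality in
    Cauchy-Schwarz forces the other entries to be equal, and the vector found in
    this way does have the power sums [p1] and [p2]. Its entries are positive
    because [p2 < p1^2] when [m > 1] ([laguerre_top_attained]). The diagonal matrix
    with the reciprocal entries is then positive definite, has the same two
    traces as [A], and has the Laguerre bound among its eigenvalues, so no valid
    formula can exceed this value at [(p1, p2)].

    The passage between matrices and power sums rests on the real spectral
    theorem [symmetric_diagonalization]. *)

(** * Diagonalization of real symmetric matrices *)

(** Over the complex extension [R[i]] the matrix is Hermitian, so it is unitarily
    similar to a diagonal matrix with real entries. Two real matrices that are
    similar over [R[i]] are already similar over [R], because some
    combination of the real and imaginary parts of the conjugating matrix with a
    real coefficient is invertible. *)
Lemma symmetric_diagonalization {R : rcfType} {n : nat} {A : 'M[R]_n} :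
  A \is symmetricmx ->
  exists (P : 'M[R]_n) (d : 'rV[R]_n),
    P \in unitmx /\ A = invmx P *m diag_mx d *m P.
Proof.
move=> Asym; pose toC := real_complex R.
have realC k l (M : 'M[R]_(k, l)) : map_mx toC M \is a mxOver Num.real.
  by apply/mxOverP => i j; rewrite mxE; apply/complex_realP; exists (M i j).
have ofReal k l (M : 'M[R[i]]_(k, l)) : M \is a mxOver Num.real ->
    exists N, M = map_mx toC N.
  move=> /mxOverP Mreal; exists (map_mx (@complex.Re R) M).
  by apply/matrixP => i j; rewrite !mxE [toC _]RRe_real.
have AC_herm : map_mx toC A \is hermsymmx.
  apply: realsym_hermsym; last exact: realC.
  move: Asym => /is_hermitianmxP; rewrite expr0 scale1r map_mx_id// => AT.
  apply/is_hermitianmxP; rewrite expr0 scale1r map_mx_id//.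
  by rewrite map_trmx -AT.
have /hermitian_normalmx/orthomx_spectralP := AC_herm.
have [d ->] := ofReal _ _ _ (hermitian_spectral_diag_real AC_herm).
set U := spectralmx _ => AC_eq; have U_unit : U \in unitmx := spectral_unit _.
have [] := @real_similar _ _ (map_mx toC A) (diag_mx (map_mx toC d)).
- exists U; first by [].
  by apply/similarP => //; rewrite [X in _ *m X]AC_eq -mulmxA mulKVmx.
- exact: realC.
- by rewrite -map_diag_mx; exact: realC.
move=> Q /andP[/ofReal[P ->]]; rewrite map_unitmx => P_unit.
move=> /similarP; rewrite map_unitmx => /(_ P_unit).
rewrite -map_diag_mx -!map_mxM => /(map_mx_inj (f := toC)) PA.
by exists P, d; split; rewrite // -mulmxA -PA mulKmx.
Qed.

Lemma eigenvalue_conj_diag {F : fieldType} {n : nat} {P : 'M[F]_n}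
    (d : 'rV[F]_n) (l : F) :
  P \in unitmx ->
  eigenvalue (invmx P *m diag_mx d *m P) l <-> exists i, l = d 0 i.
Proof.
move=> P_unit; split=> [/eigenvalueP[v v_eig v_neq0]|[i ->]].
  (* The coordinates of an eigenvector in the basis formed by the rows of [P]. *)
  have /rV0Pn[i wi_neq0] : v *m invmx P != 0.
    by apply: contra_neq v_neq0 => w0; rewrite -(mulmxKV P_unit v) w0 mul0mx.
  exists i; apply: (mulfI wi_neq0).
  have /(congr1 (mulmx^~ (invmx P))) := v_eig.
  rewrite !mulmxA mulmxK// -scalemxAl mul_mx_diag => /rowP/(_ i).
  by rewrite [LHS]mxE [RHS]mxE => ->; rewrite mulrC.
apply/eigenvalueP; exists (row i P).
  rewrite -row_mul !mulmxA mulmxV// mul1mx mul_diag_mx.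
  by apply/rowP => j; rewrite !mxE.
by rewrite rowE; apply: contraTneq isT => /(congr1 (mulmx^~ (invmx P)));
  rewrite mulmxK// mul0mx => /rowP/(_ i)/eqP; rewrite !mxE !eqxx oner_eq0.
Qed.

(** * Positive definite matrices and their inverse spectra *)

Lemma invmx_conj_diag {F : fieldType} {n : nat} {P : 'M[F]_n} {d : 'rV[F]_n} :
  P \in unitmx -> (forall i, d 0 i != 0) ->
  invmx (invmx P *m diag_mx d *m P) =
    invmx P *m diag_mx (map_mx GRing.inv d) *m P.
Proof.
move=> P_unit d_neq0; set D := diag_mx d; set E := diag_mx (map_mx _ _).
have DE : D *m E = 1%:M.
  rewrite mulmx_diag -diag_const_mx; congr diag_mx; apply/rowP => j.
  by rewrite !mxE divff.
have ME : (invmx P *m D *m P) *m (invmx P *m E *m P) = 1%:M.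
  by rewrite !mulmxA mulmxK// -(mulmxA _ D) DE mulmx1 mulVmx.
have [M_unit _] := mulmx1_unit ME.
by rewrite -[RHS](mulKmx M_unit) ME mulmx1.
Qed.

Lemma mxtrace_conj {F : fieldType} {n : nat} {P : 'M[F]_n} (M : 'M[F]_n) :
  P \in unitmx -> \tr (invmx P *m M *m P) = \tr M.
Proof. by move=> P_unit; rewrite mxtrace_mulC mulmxA mulmxV// mul1mx. Qed.

Lemma tr_inv_conj_diag {R : realType} {m : nat} {P : 'M[R]_m} {d : 'rV[R]_m} :
  P \in unitmx -> (forall i, d 0 i != 0) ->
  tr_inv (invmx P *m diag_mx d *m P) = \sum_i (d 0 i)^-1.
Proof.
move=> P_unit d_neq0; rewrite /tr_inv invmx_conj_diag// mxtrace_conj//.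
by rewrite mxtrace_diag; apply: eq_bigr => i _; rewrite mxE.
Qed.

Lemma tr_inv2_conj_diag {R : realType} {m : nat} {P : 'M[R]_m} {d : 'rV[R]_m} :
  P \in unitmx -> (forall i, d 0 i != 0) ->
  tr_inv2 (invmx P *m diag_mx d *m P) = \sum_i ((d 0 i)^-1) ^+ 2.
Proof.
move=> P_unit d_neq0; rewrite /tr_inv2 invmx_conj_diag// !mulmxA mulmxK//.
rewrite -(mulmxA _ (diag_mx _) (diag_mx _)) mxtrace_conj// mulmx_diag mxtrace_diag.
by apply: eq_bigr => i _; rewrite !mxE expr2.
Qed.

Lemma posdef_eigenvalue_gt0 {R : realType} {m : nat} {A : 'M[R]_m} {l : R} :
  sym_posdef A -> eigenvalue A l -> 0 < l.
Proof.
move=> [_ A_pos] /eigenvalueP[v v_eig v_neq0].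
have vT_neq0 : v^T != 0 by rewrite trmx_eq0.
have := A_pos _ vT_neq0; rewrite trmxK v_eig -scalemxAl mxE.
have v2_ge0 : 0 <= (v *m v^T) 0 0.
  by rewrite mxE sumr_ge0// => i _; rewrite mxE -expr2 sqr_ge0.
rewrite !ltNge; apply: contra => l_le0; exact: mulr_le0_ge0.
Qed.

Lemma posdef_diag_mx {R : realType} {m : nat} {d : 'rV[R]_m} :
  (forall i, 0 < d 0 i) -> sym_posdef (diag_mx d).
Proof.
move=> d_gt0; split.
  by apply/is_hermitianmxP; rewrite expr0 scale1r map_mx_id// tr_diag_mx.
move=> x x_neq0; rewrite mul_mx_diag mxE.
have /cV0Pn[i xi_neq0] := x_neq0.
rewrite (bigD1 i)//= ltr_wpDr//.
  apply: sumr_ge0 => j _; rewrite !mxE mulrAC -expr2.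
  by rewrite mulr_ge0 ?sqr_ge0// ltW.
by rewrite !mxE mulrAC -expr2 mulr_gt0// exprn_even_gt0.
Qed.

(** The spectrum is the finite nonempty set of the entries of [d], so it has a least
    element and the choice made by [smallest_eigenvalue] returns it. *)
Lemma smallest_eigenvalue_conj_diag {R : realType} {m : nat} {P : 'M[R]_m}
    (d : 'rV[R]_m) :
  (1 <= m)%N -> P \in unitmx ->
  exists2 k, smallest_eigenvalue (invmx P *m diag_mx d *m P) = d 0 k
           & forall i, d 0 k <= d 0 i.
Proof.
move=> m_gt0 P_unit; set A := _ *m P; pose i0 := Ordinal m_gt0.
have [k _ k_min] := Order.TotalTheory.arg_minP (fun i => d 0 i) (erefl (predT i0)).
have d_min i : d 0 k <= d 0 i by exact: k_min.
exists k => //; rewrite /smallest_eigenvalue; case: xgetP => [l _|/(_ (d 0 k))[]].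
  move=> [/= /(eigenvalue_conj_diag _ _ P_unit)[j ->] /(_ (d 0 k))]; move=> le_jk.
  apply/eqP; rewrite eq_le d_min andbT le_jk//=.
  by apply/(eigenvalue_conj_diag _ _ P_unit); exists k.
split=> /=; first by apply/(eigenvalue_conj_diag _ _ P_unit); exists k.
by move=> l /= /(eigenvalue_conj_diag _ _ P_unit)[j ->].
Qed.


(** * Extremal entries under two prescribed power sums *)

(** Cauchy-Schwarz against the constant vector, read off from the nonnegativity
    of the variance of [x] on [B]. *)
Lemma sqr_sum_le {R : realFieldType} {I : finType} (B : {pred I}) (x : I -> R) :
  (\sum_(i in B) x i) ^+ 2 <= #|B|%:R * \sum_(i in B) x i ^+ 2.
Proof.
set S := \sum_(i in B) x i; set Q := \sum_(i in B) _.
have [/eqP/pred0P B0|B_neq0] := eqVneq #|B| 0%N.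
  by rewrite /S /Q !big_pred0// expr0n/= mulr0.
set N : R := #|B|%:R; have N_gt0 : 0 < N by rewrite ltr0n lt0n.
have dev : \sum_(i in B) (N * x i - S) ^+ 2 = N * (N * Q - S ^+ 2).
  transitivity (\sum_(i in B) (N ^+ 2 * x i ^+ 2 + - (2 * N * S) * x i + S ^+ 2)).
    by apply: eq_bigr => i _; ring.
  rewrite !big_split/= -!mulr_sumr -/S -/Q sumr_const -mulr_natl -/N; ring.
by rewrite -subr_ge0 -(pmulr_rge0 _ N_gt0) -dev sumr_ge0// => i _; exact: sqr_ge0.
Qed.

(** For [0 < p1], the larger root [z] of [(p1 - z)^2 = (n - 1) (p2 - z^2)]. The square root is
    kept in normalized form, with [p1] factored out, so that the reciprocal of this
    root is the Laguerre bound term by term. *)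
Definition laguerre_top {R : realType} (n : nat) (p1 p2 : R) : R :=
  p1 * (1 + Num.sqrt ((n%:R - 1) * (n%:R * (p2 / p1 ^+ 2) - 1))) / n%:R.

Lemma laguerre_boundE {R : realType} {m : nat} (A : 'M[R]_m) :
  laguerre_bound A = (laguerre_top m (tr_inv A) (tr_inv2 A))^-1.
Proof.
rewrite /laguerre_bound /laguerre_top invf_div.
by rewrite (invfM (tr_inv A) (1 + _)) [RHS]mulrCA.
Qed.

(** Cauchy-Schwarz on the entries other than [x k] is, after multiplication by
    [n / p1^2] and completion of the square, the statement that the square of
    [n x_k / p1 - 1] is at most the radicand of [laguerre_top]. *)
Lemma le_laguerre_top {R : realType} {n : nat} (x : 'I_n -> R) (k : 'I_n) :
  0 < \sum_i x i ->
  x k <= laguerre_top n (\sum_i x i) (\sum_i x i ^+ 2).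
Proof.
move=> p1_gt0; have n_gt0 : (0 < n)%N by exact: leq_ltn_trans (ltn_ord k).
have := sqr_sum_le (predC1 k) x; rewrite cardC1 card_ord.
have -> : n.-1%:R = n%:R - 1 :> R by rewrite -subn1 natrB.
set p1 := \sum_i x i in p1_gt0 *; set p2 := \sum_i x i ^+ 2.
have -> : \sum_(i in predC1 k) x i = p1 - x k.
  by rewrite /p1 [in RHS](bigD1 k)//= addrAC subrr add0r.
have -> : \sum_(i in predC1 k) x i ^+ 2 = p2 - x k ^+ 2.
  by rewrite /p2 [in RHS](bigD1 k)//= addrAC subrr add0r.
move=> others; rewrite /laguerre_top; set s := Num.sqrt _.
have N_gt0 : 0 < n%:R :> R by rewrite ltr0n.
suff : n%:R * x k / p1 - 1 <= s.
  by rewrite lerBlDl ler_pdivrMr// ler_pdivlMr// mulrC (mulrC p1).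
apply: le_trans (ler_norm _) _; rewrite -sqrtr_sqr; apply: ler_wsqrtr.
rewrite -subr_ge0.
have -> : (n%:R - 1) * (n%:R * (p2 / p1 ^+ 2) - 1) - (n%:R * x k / p1 - 1) ^+ 2
   = n%:R * ((n%:R - 1) * (p2 - x k ^+ 2) - (p1 - x k) ^+ 2) / p1 ^+ 2.
  by field; rewrite gt_eqF.
by rewrite divr_ge0 ?sqr_ge0// mulr_ge0 ?(ltW N_gt0)// subr_ge0.
Qed.

(** The extremal vector is the equality case of Cauchy-Schwarz: the entry at [k] is
    the larger root and the others share the rest of the sum equally. *)
Lemma laguerre_top_attained {R : realType} {n : nat} (x : 'I_n -> R) (k : 'I_n) :
  (forall i, 0 < x i) ->
  exists y : 'I_n -> R, [/\ forall i, 0 < y i,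
    \sum_i y i = \sum_i x i,
    \sum_i y i ^+ 2 = \sum_i x i ^+ 2 &
    y k = laguerre_top n (\sum_i x i) (\sum_i x i ^+ 2)].
Proof.
(* For [n = 1] there are no other entries, and [x] itself is extremal. *)
move=> x_gt0; have [/eqP n1|n_neq1] := eqVneq n 1%N.
  exists x; split=> //; case: n n1 x k x_gt0 => [|[|n]]// _ x k x_gt0.
  rewrite /laguerre_top subrr mul0r sqrtr0 addr0 mulr1 divr1 !big_ord1.
  by rewrite (ord1 k).
have n_gt1 : (1 < n)%N.
  by rewrite ltn_neqAle eq_sym n_neq1 (leq_ltn_trans _ (ltn_ord k)).
have p1_gt0 : 0 < \sum_i x i.
  by rewrite (bigD1 k)//= ltr_wpDr// sumr_ge0// => i _; rewrite ltW.
have p2_lt : \sum_i x i ^+ 2 < (\sum_i x i) ^+ 2.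
  have x_lt i : x i < \sum_j x j.
    have /card_gt0P[j j_neq_i] : (0 < #|predC1 i|)%N.
      by rewrite cardC1 card_ord -subn1 subn_gt0.
    rewrite (bigD1 i)//= ltrDl (bigD1 j)//= ltr_wpDr//.
    by rewrite sumr_ge0// => l _; rewrite ltW.
  rewrite expr2 mulr_suml; apply: ltr_sum.
    by apply/hasP; exists k; rewrite ?mem_index_enum.
  by move=> i _; rewrite expr2 ltr_pM2l.
have := sqr_sum_le predT x; rewrite card_ord.
set p1 := \sum_i x i in p1_gt0 p2_lt *; set p2 := \sum_i x i ^+ 2 in p2_lt *.
move=> p2_ge; rewrite /laguerre_top; set s := Num.sqrt _.
have N_gt0 : 0 < n%:R - 1 :> R by rewrite subr_gt0 ltr1n.
have rad_ge0 : 0 <= (n%:R - 1) * (n%:R * (p2 / p1 ^+ 2) - 1).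
  rewrite mulr_ge0 ?(ltW N_gt0)// subr_ge0 mulrA ler_pdivlMr ?mul1r//.
  by rewrite exprn_gt0.
have s2 : s ^+ 2 = (n%:R - 1) * (n%:R * (p2 / p1 ^+ 2) - 1) by rewrite sqr_sqrtr.
(* This is what makes the common value [b] of the other entries positive. *)
have s_lt : s < n%:R - 1.
  rewrite -(@ltr_pXn2r _ 2%N)// ?nnegrE ?sqrtr_ge0 ?ltW// s2 [ltRHS]expr2.
  rewrite ltr_pM2l// ltrD2r gtr_pMr ?ltr0n ?(ltnW n_gt1)//.
  by rewrite ltr_pdivrMr ?mul1r// exprn_gt0.
pose a := p1 * (1 + s) / n%:R; pose b := p1 * (1 - s / (n%:R - 1)) / n%:R.
have n_gt0 : 0 < n%:R :> R by rewrite ltr0n ltnW.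
have sum_two f : \sum_(i < n) f (if i == k then a else b)
    = f a + (n%:R - 1) * f b :> R.
  rewrite (bigD1 k)//= eqxx; congr (_ + _).
  rewrite (eq_bigr (fun=> f b)) => [|i /negPf->//].
  by rewrite sumr_const cardC1 card_ord -[LHS]mulr_natl -subn1 natrB// ltnW.
exists (fun i => if i == k then a else b); split.
- move=> i; case: ifP => _; rewrite divr_gt0// mulr_gt0//.
    by rewrite ltr_wpDr// sqrtr_ge0.
  by rewrite subr_gt0 ltr_pdivrMr// mul1r.
- by rewrite (sum_two id) /a /b; field; rewrite !gt_eqF.
- rewrite (sum_two (fun z => z ^+ 2)).
  have -> : a ^+ 2 + (n%:R - 1) * b ^+ 2 =
      p1 ^+ 2 / n%:R * (1 + s ^+ 2 / (n%:R - 1)).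
    by rewrite /a /b; field; rewrite !gt_eqF.
  by rewrite s2; field; rewrite !gt_eqF.
- by rewrite eqxx.
Qed.

(** * Optimality of the Laguerre bound *)

Lemma posdef_inverse_spectrum {R : realType} {m : nat} {A : 'M[R]_m} :
  (1 <= m)%N -> sym_posdef A ->
  exists (x : 'I_m -> R) (k : 'I_m),
    [/\ forall i, 0 < x i, smallest_eigenvalue A = (x k)^-1,
        tr_inv A = \sum_i x i & tr_inv2 A = \sum_i x i ^+ 2].
Proof.
move=> m_gt0 A_pos; have [A_sym _] := A_pos.
have [P [d [P_unit A_conj]]] := symmetric_diagonalization A_sym.
have d_gt0 i : 0 < d 0 i.
  apply: (posdef_eigenvalue_gt0 A_pos); rewrite A_conj.
  by apply/(eigenvalue_conj_diag _ _ P_unit); exists i.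
have d_neq0 i : d 0 i != 0 by rewrite gt_eqF.
have [k A_min _] := smallest_eigenvalue_conj_diag d m_gt0 P_unit.
exists (fun i => (d 0 i)^-1), k; split.
- by move=> i; rewrite invr_gt0.
- by rewrite invrK A_conj.
- by rewrite A_conj tr_inv_conj_diag.
- by rewrite A_conj tr_inv2_conj_diag.
Qed.

Lemma posdef_with_inverse_spectrum {R : realType} {m : nat} {y : 'I_m -> R} :
  (1 <= m)%N -> (forall i, 0 < y i) ->
  exists D : 'M[R]_m,
    [/\ sym_posdef D, tr_inv D = \sum_i y i, tr_inv2 D = \sum_i y i ^+ 2 &
        forall k, smallest_eigenvalue D <= (y k)^-1].
Proof.
move=> m_gt0 y_gt0; pose d := \row_i (y i)^-1.
have d_gt0 i : 0 < d 0 i by rewrite mxE invr_gt0.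
have d_neq0 i : d 0 i != 0 by rewrite gt_eqF.
have inv_d i : (d 0 i)^-1 = y i by rewrite mxE invrK.
have unit1 : (1%:M : 'M[R]_m) \in unitmx by exact: unitmx1.
have D_conj : diag_mx d = invmx 1%:M *m diag_mx d *m 1%:M.
  by rewrite invmx1 mul1mx mulmx1.
exists (diag_mx d); split; first exact: posdef_diag_mx.
- by rewrite D_conj tr_inv_conj_diag//; apply: eq_bigr => i _; rewrite inv_d.
- by rewrite D_conj tr_inv2_conj_diag//; apply: eq_bigr => i _; rewrite inv_d.
- move=> k; rewrite D_conj.
  have [l -> l_min] := smallest_eigenvalue_conj_diag d m_gt0 unit1.
  by rewrite -inv_d invrK.
Qed.

Theorem theorem2p1 (R : realType) (m : nat) (hm : (1 <= m)%N) :
  (forall A : 'M[R]_m, sym_posdef A ->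
     laguerre_bound A <= smallest_eigenvalue A)
  /\
  (forall phi : R -> R -> R,
     (forall A : 'M[R]_m, sym_posdef A ->
        phi (tr_inv A) (tr_inv2 A) <= smallest_eigenvalue A) ->
     forall A : 'M[R]_m, sym_posdef A ->
       phi (tr_inv A) (tr_inv2 A) <= laguerre_bound A).
Proof.
split=> [A|phi phi_le A] /(posdef_inverse_spectrum hm)[x [k [x_gt0]]];
  move=> A_min A_tr A_tr2; rewrite laguerre_boundE A_tr A_tr2.
  have p1_gt0 : 0 < \sum_i x i.
    by rewrite (bigD1 k)//= ltr_wpDr// sumr_ge0// => i _; rewrite ltW.
  have x_le := le_laguerre_top x k p1_gt0.
  by rewrite A_min lef_pV2// posrE// (lt_le_trans _ x_le).
have [y [y_gt0 y_sum y_sum2 y_top]] := laguerre_top_attained x k x_gt0.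
have [D [D_pos D_tr D_tr2 D_min]] := posdef_with_inverse_spectrum hm y_gt0.
rewrite -y_top -y_sum -y_sum2 -D_tr -D_tr2.
exact: le_trans (phi_le D D_pos) (D_min k).
Qed.
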